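(* For a 2-z-exact 2-category $\mathcal L$ the following conditions are equivalent. (i) $\mathcal L$ is homologically self-dual: the dinversion of every antinormal decomposition of the zero map is a normal 1-cell. (ii) Homology is self-dual: for every normal chain complex $(C,d)$ in $\mathcal L$ and every $n\in\mathbb Z$, the comparison $j_n\colon \mathrm H^{\mathrm{coker}}_n(C)\to\mathrm H^{\ker}_n(C)$ is an equivalence. (iii) The Pure Snake condition holds: for all short 2-exact sequences $A\xrightarrow{a}B\xrightarrow{b}C$ and $X\xrightarrow{c}B\xrightarrow{d}Z$ through the same middle object $B$ and all 1-cells $f\colon A\to X$, $h\colon C\to Z$ with $a\cong c\circ f$ and $h\circ b\cong d$, the comparison $j\colon\mathrm{Cok}(f)\to\mathrm{Ker}(h)$, characterised by $\ker(h)\circ j\circ\operatorname{coker}(f)\cong b\circ c$, is an equivalence.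
   Context: 2-categories are strict. For 1-cells, $\cong$ means that there is an invertible 2-cell between them. Whiskering is denoted $\star$. A bizero object of a 2-category $\mathcal L$ is an object $0$ such that for every object $A$ the hom-categories $\mathcal L(A,0)$ and $\mathcal L(0,A)$ are equivalent to the terminal category. A 1-cell is null if it factors through $0$; $f\cong 0$ means that $f$ is isomorphic to a null 1-cell. The bizero object is strong if between any two parallel 1-cells that factor through $0$ there is exactly one 2-cell. In a 2-category with a strong bizero object, a 2-kernel of $f\colon A\to B$ is a 1-cell $k\colon K\to A$ with an invertible 2-cell $f\circ k\cong 0$ such that (1) for every $z\colon Z\to A$ with $f\circ z\cong0$ there is $u\colon Z\to K$ with $k\circ u\cong z$; (2) for all $u,v\colon Z\to K$ and every 2-cell $\lambda\colon k\circ u\Rightarrow k\circ v$ there is a unique 2-cell $\mu\colon u\Rightarrow v$ with $k\star\mu=\lambda$. 2-cokernels are defined dually. They are unique up to equivalence and are written $\ker(f)\colon\mathrm{Ker}(f)\to A$ and $\operatorname{coker}(f)\colon B\to\mathrm{Cok}(f)$. A 2-z-exact 2-category is a 2-category with a strong bizero object having all 2-kernels and all 2-cokernels. A normal 2-monomorphism is a 1-cell which is a 2-kernel of some 1-cell; a normal 2-epimorphism is a 1-cell which is a 2-cokernel of some 1-cell. A 1-cell is normal if it is isomorphic to $m\circ e$ with $e$ a normal 2-epimorphism and $m$ a normal 2-monomorphism. A short 2-exact sequence is a composable pair $K\xrightarrow{k}A\xrightarrow{q}Q$ such that $k$ is a 2-kernel of $q$ and $q$ is a 2-cokernel of $k$.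 For any 1-cell $f\colon A\to B$ put $\mathrm{coim}(f)=\operatorname{coker}(\ker(f))\colon A\to\mathrm{Coim}(f)$ and $\mathrm{im}(f)=\ker(\operatorname{coker}(f))\colon\mathrm{Im}(f)\to B$. There is a comparison $j_f\colon\mathrm{Coim}(f)\to\mathrm{Im}(f)$, unique up to a unique compatible invertible 2-cell, with $\mathrm{im}(f)\circ j_f\circ\mathrm{coim}(f)\cong f$. For normal $f\cong m\circ e$ with $e$ a normal 2-epimorphism and $m$ a normal 2-monomorphism, $m$ is $\mathrm{im}(f)$ and $e$ is $\mathrm{coim}(f)$ up to equivalence. An antinormal pair $(m,e)$ consists of a normal 2-monomorphism $m\colon K\to X$ and a normal 2-epimorphism $e\colon X\to R$; its dinversion is $w=\operatorname{coker}(m)\circ\ker(e)\colon\mathrm{Ker}(e)\to\mathrm{Cok}(m)$. It is an antinormal decomposition of the zero map if $e\circ m\cong0$. A normal chain complex $(C,d)$ is a sequence of normal 1-cells $d_n\colon C_n\to C_{n-1}$, $n\in\mathbb Z$, with $d_n\circ d_{n+1}\cong 0$. Then $\mathrm{im}(d_{n+1})$ factors through $\ker(d_n)$ and $\mathrm{coim}(d_n)$ factors through $\operatorname{coker}(d_{n+1})$, and one sets $\mathrm H^{\mathrm{coker}}_n(C)=\mathrm{Cok}(\mathrm{Im}(d_{n+1})\to\mathrm{Ker}(d_n))$ and $\mathrm H^{\ker}_n(C)=\mathrm{Ker}(\mathrm{Cok}(d_{n+1})\to\mathrm{Coim}(d_n))$. Equivalently, with $w_n=\operatorname{coker}(d_{n+1})\circ\ker(d_n)$,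 one has $\mathrm H^{\mathrm{coker}}_n(C)=\mathrm{Coim}(w_n)$ and $\mathrm H^{\ker}_n(C)=\mathrm{Im}(w_n)$, and $j_n$ is by definition the comparison $j_{w_n}$. *)

(* Defs.v *)
From Stdlib Require Import ZArith.

Set Implicit Arguments.
Unset Strict Implicit.
Unset Printing Implicit Defensive.

Declare Scope twocat_scope.
Delimit Scope twocat_scope with twocat.

(** * Strict 2-categories *)

Record twoData := TwoData {
  obj :> Type;
  hom : obj -> obj -> Type;
  cell : forall A B : obj, hom A B -> hom A B -> Type;
  id1 : forall A, hom A A;
  comp : forall A B C, hom B C -> hom A B -> hom A C;
  id2 : forall A B (f : hom A B), cell f f;
  vcomp : forall A B (f g h : hom A B), cell g h -> cell f g -> cell f h;
  lwhisker : forall A B C (g : hom B C) (f f' : hom A B),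
    cell f f' -> cell (comp g f) (comp g f');
  rwhisker : forall A B C (g g' : hom B C), cell g g' ->
    forall f : hom A B, cell (comp g f) (comp g' f)
}.

Arguments hom {t}.
Arguments cell {t A B}.
Arguments id1 {t}.
Arguments comp {t A B C}.
Arguments id2 {t A B}.
Arguments vcomp {t A B f g h}.
Arguments lwhisker {t A B C} g {f f'}.
Arguments rwhisker {t A B C g g'} _ f.

Notation "f ⇒ g" := (cell f g) (at level 70) : twocat_scope.
Notation "g ∘ f" := (comp g f) (at level 40, left associativity) : twocat_scope.
Notation "b • a" := (vcomp b a) (at level 45, left associativity) : twocat_scope.
Notation "g ◁ a" := (lwhisker g a) (at level 38, right associativity) : twocat_scope.
Notation "b ▷ f" := (rwhisker b f) (at level 38, right associativity) : twocat_scope.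
Local Open Scope twocat_scope.

Definition cell_of_eq (L : twoData) (A B : L) (f g : hom A B) (e : f = g) : f ⇒ g :=
  match e in _ = g0 return f ⇒ g0 with eq_refl => id2 f end.

(* Composition of 1-cells is strictly associative and unital.  For 2-cells the
   corresponding equations hold along these equalities of 1-cells, which
   [cell_of_eq] turns into 2-cells. *)
Record twoCategory := TwoCategory {
  twoData_of :> twoData;
  comp_assoc : forall (A B C D : twoData_of) (h : hom C D) (g : hom B C) (f : hom A B),
    h ∘ (g ∘ f) = h ∘ g ∘ f;
  comp_id_l : forall (A B : twoData_of) (f : hom A B), id1 B ∘ f = f;
  comp_id_r : forall (A B : twoData_of) (f : hom A B), f ∘ id1 A = f;
  vcomp_assoc : forall (A B : twoData_of) (f g h k : hom A B)
      (c : h ⇒ k) (b : g ⇒ h) (a : f ⇒ g),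
    c • (b • a) = c • b • a;
  vcomp_id_l : forall (A B : twoData_of) (f g : hom A B) (a : f ⇒ g), id2 g • a = a;
  vcomp_id_r : forall (A B : twoData_of) (f g : hom A B) (a : f ⇒ g), a • id2 f = a;
  lwhisker_id : forall (A B C : twoData_of) (g : hom B C) (f : hom A B),
    g ◁ id2 f = id2 (g ∘ f);
  lwhisker_vcomp : forall (A B C : twoData_of) (g : hom B C) (f f' f'' : hom A B)
      (b : f' ⇒ f'') (a : f ⇒ f'),
    g ◁ (b • a) = (g ◁ b) • (g ◁ a);
  rwhisker_id : forall (A B C : twoData_of) (g : hom B C) (f : hom A B),
    id2 g ▷ f = id2 (g ∘ f);
  rwhisker_vcomp : forall (A B C : twoData_of) (g g' g'' : hom B C) (f : hom A B)
      (b : g' ⇒ g'') (a : g ⇒ g'),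
    (b • a) ▷ f = (b ▷ f) • (a ▷ f);
  interchange : forall (A B C : twoData_of) (g g' : hom B C) (f f' : hom A B)
      (b : g ⇒ g') (a : f ⇒ f'),
    (b ▷ f') • (g ◁ a) = (g' ◁ a) • (b ▷ f);
  lwhisker_comp : forall (A B C D : twoData_of) (h : hom C D) (g : hom B C)
      (f f' : hom A B) (a : f ⇒ f'),
    cell_of_eq (comp_assoc h g f') • (h ◁ (g ◁ a))
      = ((h ∘ g) ◁ a) • cell_of_eq (comp_assoc h g f);
  lrwhisker_comp : forall (A B C D : twoData_of) (h : hom C D) (g g' : hom B C)
      (f : hom A B) (b : g ⇒ g'),
    cell_of_eq (comp_assoc h g' f) • (h ◁ (b ▷ f))
      = ((h ◁ b) ▷ f) • cell_of_eq (comp_assoc h g f);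
  rwhisker_comp : forall (A B C D : twoData_of) (h h' : hom C D) (g : hom B C)
      (f : hom A B) (c : h ⇒ h'),
    cell_of_eq (comp_assoc h' g f) • (c ▷ (g ∘ f))
      = ((c ▷ g) ▷ f) • cell_of_eq (comp_assoc h g f);
  lwhisker_id1 : forall (A B : twoData_of) (f f' : hom A B) (a : f ⇒ f'),
    cell_of_eq (comp_id_l f') • (id1 B ◁ a) = a • cell_of_eq (comp_id_l f);
  rwhisker_id1 : forall (A B : twoData_of) (f f' : hom A B) (a : f ⇒ f'),
    cell_of_eq (comp_id_r f') • (a ▷ id1 A) = a • cell_of_eq (comp_id_r f)
}.

Definition invertible (L : twoCategory) (A B : L) (f g : hom A B) (a : f ⇒ g) : Prop :=
  exists b : g ⇒ f, b • a = id2 f /\ a • b = id2 g.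

Definition iso1 (L : twoCategory) (A B : L) (f g : hom A B) : Prop :=
  exists a : f ⇒ g, invertible a.
Notation "f ≅ g" := (iso1 f g) (at level 70) : twocat_scope.

Definition is_equivalence (L : twoCategory) (A B : L) (f : hom A B) : Prop :=
  exists g : hom B A, g ∘ f ≅ id1 A /\ f ∘ g ≅ id1 B.

(** * Strong bizero objects *)

(* An equivalence between [L(A,B)] and the terminal category: a functor from the
   terminal category picks the object [c], the functor back is the unique one,
   and the only non-trivial datum left is a natural isomorphism from the constant
   endofunctor at [c] to the identity, with components [eta]. *)
Definition hom_equiv_terminal (L : twoCategory) (A B : L) : Prop :=
  exists (c : hom A B) (eta : forall f : hom A B, c ⇒ f),
    (forall f, invertible (eta f)) /\
    (forall (f g : hom A B) (a : f ⇒ g), a • eta f = eta g • id2 c).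

Definition is_bizero (L : twoCategory) (z : L) : Prop :=
  forall A : L, hom_equiv_terminal A z /\ hom_equiv_terminal z A.

Definition factors_through (L : twoCategory) (z A B : L) (f : hom A B) : Prop :=
  exists (a : hom A z) (b : hom z B), f = b ∘ a.

Definition is_strong_bizero (L : twoCategory) (z : L) : Prop :=
  is_bizero z /\
  forall (A B : L) (f g : hom A B),
    factors_through z f -> factors_through z g -> exists! a : f ⇒ g, True.

Record bizeroTwoCategory := BizeroTwoCategory {
  twoCategory_of :> twoCategory;
  zero : twoCategory_of;
  zero_strong_bizero : is_strong_bizero zero
}.

Definition null (L : bizeroTwoCategory) (A B : L) (f : hom A B) : Prop :=
  factors_through (zero L) f.

Definition iso_null (L : bizeroTwoCategory) (A B : L) (f : hom A B) : Prop :=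
  exists o : hom A B, null o /\ f ≅ o.

(** * 2-kernels and 2-cokernels *)

Definition is_2kernel (L : bizeroTwoCategory) (A B K : L) (f : hom A B) (k : hom K A) : Prop :=
  iso_null (f ∘ k) /\
  (forall (Z : L) (z : hom Z A), iso_null (f ∘ z) -> exists u : hom Z K, k ∘ u ≅ z) /\
  (forall (Z : L) (u v : hom Z K) (l : k ∘ u ⇒ k ∘ v), exists! m : u ⇒ v, k ◁ m = l).

Definition is_2cokernel (L : bizeroTwoCategory) (A B Q : L) (f : hom A B) (q : hom B Q) : Prop :=
  iso_null (q ∘ f) /\
  (forall (Z : L) (z : hom B Z), iso_null (z ∘ f) -> exists u : hom Q Z, u ∘ q ≅ z) /\
  (forall (Z : L) (u v : hom Q Z) (l : u ∘ q ⇒ v ∘ q), exists! m : u ⇒ v, m ▷ q = l).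

Definition is_2z_exact (L : bizeroTwoCategory) : Prop :=
  (forall (A B : L) (f : hom A B), exists (K : L) (k : hom K A), is_2kernel f k) /\
  (forall (A B : L) (f : hom A B), exists (Q : L) (q : hom B Q), is_2cokernel f q).

Definition is_normal_mono (L : bizeroTwoCategory) (K A : L) (m : hom K A) : Prop :=
  exists (B : L) (f : hom A B), is_2kernel f m.

Definition is_normal_epi (L : bizeroTwoCategory) (B Q : L) (e : hom B Q) : Prop :=
  exists (A : L) (f : hom A B), is_2cokernel f e.

Definition is_normal (L : bizeroTwoCategory) (A B : L) (f : hom A B) : Prop :=
  exists (I : L) (e : hom A I) (m : hom I B),
    is_normal_epi e /\ is_normal_mono m /\ f ≅ m ∘ e.

Definition short_2exact (L : bizeroTwoCategory) (K A Q : L)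
    (k : hom K A) (q : hom A Q) : Prop :=
  is_2kernel q k /\ is_2cokernel k q.

(* 2-kernels and 2-cokernels are only determined up to equivalence; [is_coim f p]
   says that [p] is coker(ker(f)) for some choice of ker(f), and dually. *)
Definition is_coim (L : bizeroTwoCategory) (A B I : L) (f : hom A B) (p : hom A I) : Prop :=
  exists (K : L) (k : hom K A), is_2kernel f k /\ is_2cokernel k p.

Definition is_im (L : bizeroTwoCategory) (A B I : L) (f : hom A B) (i : hom I B) : Prop :=
  exists (Q : L) (q : hom B Q), is_2cokernel f q /\ is_2kernel q i.

(* [j] is the comparison between the codomain of [p] and the domain of [i] induced
   by [f].  For [p] a coimage and [i] an image of [f] this is the comparison j_f. *)
Definition is_comparison (L : bizeroTwoCategory) (A B I J : L) (f : hom A B)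
    (p : hom A I) (i : hom J B) (j : hom I J) : Prop :=
  i ∘ j ∘ p ≅ f.

(** * Antinormal decompositions of the zero map *)

Definition homologically_self_dual (L : bizeroTwoCategory) : Prop :=
  forall (K X R : L) (m : hom K X) (e : hom X R),
    is_normal_mono m -> is_normal_epi e -> iso_null (e ∘ m) ->
    forall (M N : L) (q : hom X N) (k : hom M X),
      is_2cokernel m q -> is_2kernel e k -> is_normal (q ∘ k).

(** * Normal chain complexes and their homology *)

(* [diff C n] is the differential d_{n+1} : C_{n+1} -> C_n, so that consecutive
   differentials compose without a transport along [n + 1 - 1 = n]. *)
Record normalComplex (L : bizeroTwoCategory) := NormalComplex {
  term :> Z -> L;
  diff : forall n : Z, hom (term (n + 1)%Z) (term n);
  diff_normal : forall n, is_normal (diff n);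
  diff_null : forall n, iso_null (diff n ∘ diff (n + 1)%Z)
}.

(* The next two definitions are about a composable pair d' : A -> B, d : B -> C.
   [is_Hcoker d' k p], for [k] a 2-kernel of [d]: [p] is a 2-cokernel of the
   factorisation Im(d') -> Ker(d) of im(d') through [k]. *)
Definition is_Hcoker (L : bizeroTwoCategory) (A B K H : L)
    (d' : hom A B) (k : hom K B) (p : hom K H) : Prop :=
  exists (I : L) (i : hom I B) (u : hom I K),
    is_im d' i /\ k ∘ u ≅ i /\ is_2cokernel u p.

(* [is_Hker d q i], for [q] a 2-cokernel of [d']: [i] is a 2-kernel of the
   factorisation Cok(d') -> Coim(d) of coim(d) through [q]. *)
Definition is_Hker (L : bizeroTwoCategory) (B C Q H : L)
    (d : hom B C) (q : hom B Q) (i : hom H Q) : Prop :=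
  exists (I : L) (e : hom B I) (v : hom Q I),
    is_coim d e /\ v ∘ q ≅ e /\ is_2kernel v i.

(* The homology considered is the one in degree n+1; n ranges over all integers. *)
Definition homology_self_dual (L : bizeroTwoCategory) : Prop :=
  forall (C : normalComplex L) (n : Z)
    (K Q : L) (k : hom K (C (n + 1)%Z)) (q : hom (C (n + 1)%Z) Q),
    is_2kernel (diff C n) k -> is_2cokernel (diff C (n + 1)%Z) q ->
    forall (Hc Hk : L) (p : hom K Hc) (i : hom Hk Q),
      is_Hcoker (diff C (n + 1)%Z) k p -> is_Hker (diff C n) q i ->
      forall j : hom Hc Hk, is_comparison (q ∘ k) p i j -> is_equivalence j.

(** * The Pure Snake condition *)

Definition pure_snake (L : bizeroTwoCategory) : Prop :=
  forall (A B C X Z : L) (a : hom A B) (b : hom B C) (c : hom X B) (d : hom B Z)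
    (f : hom A X) (h : hom C Z),
    short_2exact a b -> short_2exact c d -> a ≅ c ∘ f -> h ∘ b ≅ d ->
    forall (Q K : L) (q : hom X Q) (k : hom K C),
      is_2cokernel f q -> is_2kernel h k ->
      forall j : hom Q K, is_comparison (b ∘ c) q k j -> is_equivalence j.

(** * Existence of the comparisons *)

Lemma iso1_refl (L : twoCategory) (A B : L) (f : hom A B) : f ≅ f.
Proof. exists (id2 f), (id2 f); split; apply vcomp_id_l. Qed.

Lemma iso1_sym (L : twoCategory) (A B : L) (f g : hom A B) : f ≅ g -> g ≅ f.
Proof. intros [a [b [H1 H2]]]; exists b, a; split; assumption. Qed.

Lemma iso1_eq (L : twoCategory) (A B : L) (f g : hom A B) : f = g -> f ≅ g.
Proof. intros ->; apply iso1_refl. Qed.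

Lemma vcomp_cancel (L : twoCategory) (A B : L) (f g h : hom A B)
    (a : f ⇒ g) (a' : g ⇒ f) (x y : h ⇒ f) :
  a' • a = id2 f -> a • x = a • y -> x = y.
Proof.
intros H E; rewrite <- (vcomp_id_l x), <- (vcomp_id_l y), <- H.
now rewrite <- !vcomp_assoc, E.
Qed.

Lemma vcomp_cancel_r (L : twoCategory) (A B : L) (f g h : hom A B)
    (a : f ⇒ g) (a' : g ⇒ f) (x y : g ⇒ h) :
  a • a' = id2 g -> x • a = y • a -> x = y.
Proof.
intros H E; rewrite <- (vcomp_id_r x), <- (vcomp_id_r y), <- H.
now rewrite !vcomp_assoc, E.
Qed.

Lemma invertible_vcomp (L : twoCategory) (A B : L) (f g h : hom A B)
    (b : g ⇒ h) (a : f ⇒ g) : invertible b -> invertible a -> invertible (b • a).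
Proof.
intros [b' [H1 H2]] [a' [H3 H4]]; exists (a' • b'); split.
- now rewrite vcomp_assoc, <- (vcomp_assoc a' b' b), H1, vcomp_id_r.
- now rewrite vcomp_assoc, <- (vcomp_assoc b a a'), H4, vcomp_id_r.
Qed.

Lemma iso1_trans (L : twoCategory) (A B : L) (f g h : hom A B) :
  f ≅ g -> g ≅ h -> f ≅ h.
Proof. intros [a Ha] [b Hb]; exists (b • a); now apply invertible_vcomp. Qed.

Lemma iso1_comp (L : twoCategory) (A B C : L) (g g' : hom B C) (f f' : hom A B) :
  g ≅ g' -> f ≅ f' -> g ∘ f ≅ g' ∘ f'.
Proof.
intros [b [b' [H1 H2]]] [a [a' [H3 H4]]].
apply iso1_trans with (g ∘ f').
- exists (g ◁ a), (g ◁ a'); split;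
  now rewrite <- lwhisker_vcomp, ?H3, ?H4, lwhisker_id.
- exists (b ▷ f'), (b' ▷ f'); split;
  now rewrite <- rwhisker_vcomp, ?H1, ?H2, rwhisker_id.
Qed.

Lemma iso_null_iso1 (L : bizeroTwoCategory) (A B : L) (f g : hom A B) :
  f ≅ g -> iso_null f -> iso_null g.
Proof.
intros E [o [Ho E']]; exists o; split; trivial.
exact (iso1_trans (iso1_sym E) E').
Qed.

Lemma iso_null_comp_l (L : bizeroTwoCategory) (A B C : L) (g : hom B C) (f : hom A B) :
  iso_null f -> iso_null (g ∘ f).
Proof.
intros [o [[a [b Ho]] E]]; exists (g ∘ o); split.
- exists a, (g ∘ b); rewrite Ho; apply comp_assoc.
- exact (iso1_comp (iso1_refl g) E).
Qed.

Lemma iso_null_comp_r (L : bizeroTwoCategory) (A B C : L) (g : hom B C) (f : hom A B) :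
  iso_null g -> iso_null (g ∘ f).
Proof.
intros [o [[a [b Ho]] E]]; exists (o ∘ f); split.
- exists (a ∘ f), b; rewrite Ho; symmetry; apply comp_assoc.
- exact (iso1_comp E (iso1_refl f)).
Qed.

Definition lff (L : twoCategory) (K A : L) (k : hom K A) : Prop :=
  forall (Z : L) (u v : hom Z K) (l : k ∘ u ⇒ k ∘ v), exists! m : u ⇒ v, k ◁ m = l.

Definition rff (L : twoCategory) (B Q : L) (q : hom B Q) : Prop :=
  forall (Z : L) (u v : hom Q Z) (l : u ∘ q ⇒ v ∘ q), exists! m : u ⇒ v, m ▷ q = l.

Lemma lff_iso1 (L : twoCategory) (K A Z : L) (k : hom K A) (u v : hom Z K) :
  lff k -> k ∘ u ≅ k ∘ v -> u ≅ v.
Proof.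
intros ff [l [l' [H1 H2]]].
destruct (ff _ _ _ l) as [m [Hm _]], (ff _ _ _ l') as [m' [Hm' _]].
exists m, m'; split.
- destruct (ff _ _ _ (id2 (k ∘ u))) as [x [_ U]].
  transitivity x; [symmetry|]; apply U.
  + now rewrite lwhisker_vcomp, Hm, Hm'.
  + apply lwhisker_id.
- destruct (ff _ _ _ (id2 (k ∘ v))) as [x [_ U]].
  transitivity x; [symmetry|]; apply U.
  + now rewrite lwhisker_vcomp, Hm, Hm'.
  + apply lwhisker_id.
Qed.

Lemma rff_iso1 (L : twoCategory) (B Q Z : L) (q : hom B Q) (u v : hom Q Z) :
  rff q -> u ∘ q ≅ v ∘ q -> u ≅ v.
Proof.
intros ff [l [l' [H1 H2]]].
destruct (ff _ _ _ l) as [m [Hm _]], (ff _ _ _ l') as [m' [Hm' _]].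
exists m, m'; split.
- destruct (ff _ _ _ (id2 (u ∘ q))) as [x [_ U]].
  transitivity x; [symmetry|]; apply U.
  + now rewrite rwhisker_vcomp, Hm, Hm'.
  + apply rwhisker_id.
- destruct (ff _ _ _ (id2 (v ∘ q))) as [x [_ U]].
  transitivity x; [symmetry|]; apply U.
  + now rewrite rwhisker_vcomp, Hm, Hm'.
  + apply rwhisker_id.
Qed.

Lemma cell_of_eqK (L : twoCategory) (A B : L) (f g : hom A B) (e : f = g) :
  exists c : g ⇒ f, c • cell_of_eq e = id2 f /\ cell_of_eq e • c = id2 g.
Proof. destruct e; exists (id2 f); split; apply vcomp_id_l. Qed.

Lemma lff_of_iso1 (L : twoCategory) (K A : L) (k k' : hom K A) :
  k ≅ k' -> lff k -> lff k'.
Proof.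
intros [a [a' [H1 H2]]] ff Z u v l.
assert (K1 : forall w : hom Z K, (a' ▷ w) • (a ▷ w) = id2 (k ∘ w))
  by (intro w; now rewrite <- rwhisker_vcomp, H1, rwhisker_id).
assert (K2 : forall w : hom Z K, (a ▷ w) • (a' ▷ w) = id2 (k' ∘ w))
  by (intro w; now rewrite <- rwhisker_vcomp, H2, rwhisker_id).
destruct (ff _ _ _ ((a' ▷ v) • l • (a ▷ u))) as [m [Hm U]].
exists m; split.
- apply (vcomp_cancel_r (K2 u)).
  now rewrite <- interchange, Hm, !vcomp_assoc, K2, vcomp_id_l.
- intros m' Hm'; apply U.
  now rewrite <- Hm', <- vcomp_assoc, <- interchange, vcomp_assoc, K1, vcomp_id_l.
Qed.

Lemma rff_of_iso1 (L : twoCategory) (B Q : L) (q q' : hom B Q) :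
  q ≅ q' -> rff q -> rff q'.
Proof.
intros [a [a' [H1 H2]]] ff Z u v l.
assert (K1 : forall w : hom Q Z, (w ◁ a') • (w ◁ a) = id2 (w ∘ q))
  by (intro w; now rewrite <- lwhisker_vcomp, H1, lwhisker_id).
assert (K2 : forall w : hom Q Z, (w ◁ a) • (w ◁ a') = id2 (w ∘ q'))
  by (intro w; now rewrite <- lwhisker_vcomp, H2, lwhisker_id).
destruct (ff _ _ _ ((v ◁ a') • l • (u ◁ a))) as [m [Hm U]].
exists m; split.
- apply (vcomp_cancel_r (K2 u)).
  now rewrite interchange, Hm, !vcomp_assoc, K2, vcomp_id_l.
- intros m' Hm'; apply U.
  now rewrite <- Hm', <- vcomp_assoc, interchange, vcomp_assoc, K1, vcomp_id_l.
Qed.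

Lemma lff_cancel (L : twoCategory) (J K A : L) (k : hom K A) (u : hom J K) :
  lff k -> lff (k ∘ u) -> lff u.
Proof.
intros ffk ffku Z x y l.
destruct (cell_of_eqK (comp_assoc k u x)) as [cx [X1 X2]].
destruct (cell_of_eqK (comp_assoc k u y)) as [cy [Y1 Y2]].
destruct (ffku _ _ _ (cell_of_eq (comp_assoc k u y) • (k ◁ l) • cx)) as [m [Hm U]].
exists m; split.
- destruct (ffk _ _ _ (k ◁ l)) as [n [_ V]].
  transitivity n; [symmetry|]; apply V; trivial.
  apply (vcomp_cancel Y1).
  now rewrite lwhisker_comp, Hm, <- vcomp_assoc, X1, vcomp_id_r.
- intros m' Hm'; apply U.
  now rewrite <- Hm', lwhisker_comp, <- vcomp_assoc, X2, vcomp_id_r.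
Qed.

Lemma rff_cancel (L : twoCategory) (B Q I : L) (v : hom Q I) (q : hom B Q) :
  rff q -> rff (v ∘ q) -> rff v.
Proof.
intros ffq ffvq Z x y l.
destruct (cell_of_eqK (comp_assoc x v q)) as [cx [X1 X2]].
destruct (cell_of_eqK (comp_assoc y v q)) as [cy [Y1 Y2]].
destruct (ffvq _ _ _ (cy • (l ▷ q) • cell_of_eq (comp_assoc x v q))) as [m [Hm U]].
exists m; split.
- destruct (ffq _ _ _ (l ▷ q)) as [n [_ V]].
  transitivity n; [symmetry|]; apply V; trivial.
  apply (vcomp_cancel_r X2).
  now rewrite <- rwhisker_comp, Hm, !vcomp_assoc, Y2, vcomp_id_l.
- intros m' Hm'; apply U.
  rewrite <- Hm'; apply (vcomp_cancel Y1).
  now rewrite rwhisker_comp, !vcomp_assoc, Y2, vcomp_id_l.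
Qed.

Lemma iso_null_rff (L : bizeroTwoCategory) (B Q C : L) (q : hom B Q) (t : hom Q C) :
  rff q -> iso_null (t ∘ q) -> iso_null t.
Proof.
intros ff [o [[a [b Ho]] E]].
destruct (zero_strong_bizero L) as [bz st].
destruct (bz Q) as [[c _] _].
exists (b ∘ c); split; [now exists c, b|].
apply (rff_iso1 ff), (iso1_trans E).
destruct (st _ _ o (b ∘ c ∘ q)) as [x _].
  now exists a, b.
  now exists (c ∘ q), b; rewrite comp_assoc.
destruct (st _ _ (b ∘ c ∘ q) o) as [y _].
  now exists (c ∘ q), b; rewrite comp_assoc.
  now exists a, b.
exists x, y; split.
- destruct (st _ _ o o) as [w [_ U]]; [now exists a, b..|].
  transitivity w; [symmetry|]; now apply U.
- destruct (st _ _ (b ∘ c ∘ q) (b ∘ c ∘ q)) as [w [_ U]];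
    [now exists (c ∘ q), b; rewrite comp_assoc..|].
  transitivity w; [symmetry|]; now apply U.
Qed.

Lemma comparison_of_null (L : bizeroTwoCategory) (A B K J N M : L)
    (f : hom A B) (k : hom K A) (p : hom A J) (g : hom B N) (i : hom M B) :
  is_2cokernel k p -> is_2kernel g i -> iso_null (f ∘ k) -> iso_null (g ∘ f) ->
  exists j : hom J M, is_comparison f p i j.
Proof.
intros [_ [lift ff]] [_ [lift' _]] fk gf.
destruct (lift _ f fk) as [t Ht].
destruct (lift' _ t) as [j Hj].
- apply (iso_null_rff ff), (@iso_null_iso1 L _ _ (g ∘ f)); trivial.
  apply iso1_trans with (g ∘ (t ∘ p)); [|apply iso1_eq, comp_assoc].
  apply (iso1_comp (iso1_refl g) (iso1_sym Ht)).
- exists j; apply iso1_trans with (t ∘ p); trivial.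
  exact (iso1_comp Hj (iso1_refl p)).
Qed.

Lemma comparison_exists (L : bizeroTwoCategory) (A B J M : L)
    (f : hom A B) (p : hom A J) (i : hom M B) :
  is_coim f p -> is_im f i -> exists j : hom J M, is_comparison f p i j.
Proof.
intros [K [k [Hk Hp]]] [N [g [Hg Hi]]].
exact (comparison_of_null Hp Hi (proj1 Hk) (proj1 Hg)).
Qed.

Lemma pure_snake_comparison_exists (L : bizeroTwoCategory) (A B C X Z Q K : L)
    (a : hom A B) (b : hom B C) (c : hom X B) (d : hom B Z) (f : hom A X) (h : hom C Z)
    (q : hom X Q) (k : hom K C) :
  short_2exact a b -> short_2exact c d -> a ≅ c ∘ f -> h ∘ b ≅ d ->
  is_2cokernel f q -> is_2kernel h k -> exists j, is_comparison (b ∘ c) q k j.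
Proof.
intros [Ha _] [Hc _] Ef Eh Hq Hk; apply (comparison_of_null Hq Hk).
- apply (@iso_null_iso1 L _ _ (b ∘ a)); [|apply Ha].
  apply iso1_trans with (b ∘ (c ∘ f)); [|apply iso1_eq, comp_assoc].
  exact (iso1_comp (iso1_refl b) Ef).
- apply (@iso_null_iso1 L _ _ (d ∘ c)); [|apply Hc].
  apply iso1_trans with (h ∘ b ∘ c); [|apply iso1_sym, iso1_eq, comp_assoc].
  exact (iso1_comp (iso1_sym Eh) (iso1_refl c)).
Qed.

(* The objects H^coker and H^ker are the coimage and the image of
   w = coker(d') ∘ ker(d), so the comparison between them is j_w. *)
Lemma Hcoker_is_coim (L : bizeroTwoCategory) (A B C K Q H : L)
    (d' : hom A B) (d : hom B C) (k : hom K B) (q : hom B Q) (p : hom K H) :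
  is_2kernel d k -> is_2cokernel d' q -> is_Hcoker d' k p -> is_coim (q ∘ k) p.
Proof.
intros [_ [_ ffk]] [q0 [qlift _]] [I [i [u [[Q' [q' [Hq' Hi]]] [Eu Hp]]]]].
exists I, u; split; trivial.
destruct Hq' as [q'0 [q'lift _]], Hi as [i0 [ilift ffi]].
destruct (qlift _ q' q'0) as [s Es], (q'lift _ q q0) as [t Et].
split; [|split].
- apply (@iso_null_iso1 L _ _ (t ∘ (q' ∘ i))); [|now apply iso_null_comp_l].
  rewrite comp_assoc, <- comp_assoc.
  apply (iso1_trans (iso1_comp (iso1_refl t) (iso1_comp (iso1_refl q') (iso1_sym Eu)))).
  rewrite !comp_assoc; exact (iso1_comp (iso1_comp Et (iso1_refl k)) (iso1_refl u)).
- intros Z z Hz; destruct (ilift _ (k ∘ z)) as [x Ex].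
  + apply (@iso_null_iso1 L _ _ (s ∘ (q ∘ k ∘ z))); [|now apply iso_null_comp_l].
    rewrite !comp_assoc; exact (iso1_comp (iso1_comp Es (iso1_refl k)) (iso1_refl z)).
  + exists x; apply (lff_iso1 ffk); rewrite comp_assoc.
    exact (iso1_trans (iso1_comp Eu (iso1_refl x)) Ex).
- exact (lff_cancel ffk (lff_of_iso1 (iso1_sym Eu) ffi)).
Qed.

Lemma Hker_is_im (L : bizeroTwoCategory) (A B C K Q H : L)
    (d' : hom A B) (d : hom B C) (k : hom K B) (q : hom B Q) (i : hom H Q) :
  is_2kernel d k -> is_2cokernel d' q -> is_Hker d q i -> is_im (q ∘ k) i.
Proof.
intros [k0 [klift _]] [_ [_ ffq]] [I [e [v [[K' [k' [Hk' He]]] [Ev Hi]]]]].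
exists I, v; split; trivial.
destruct Hk' as [k'0 [k'lift _]], He as [e0 [elift ffe]].
destruct (klift _ k' k'0) as [s Es], (k'lift _ k k0) as [t Et].
split; [|split].
- apply (@iso_null_iso1 L _ _ (e ∘ k' ∘ t)); [|now apply iso_null_comp_r].
  rewrite comp_assoc, <- comp_assoc.
  exact (iso1_comp (iso1_sym Ev) Et).
- intros Z z Hz; destruct (elift _ (z ∘ q)) as [x Ex].
  + apply (@iso_null_iso1 L _ _ (z ∘ (q ∘ k) ∘ s)); [|now apply iso_null_comp_r].
    rewrite comp_assoc, <- comp_assoc.
    exact (iso1_comp (iso1_refl _) Es).
  + exists x; apply (rff_iso1 ffq); rewrite <- comp_assoc.
    exact (iso1_trans (iso1_comp (iso1_refl x) Ev) Ex).
- exact (rff_cancel ffq (rff_of_iso1 (iso1_sym Ev) ffe)).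
Qed.

(* Main.v *)
Require Import Defs.
From Stdlib Require Import ZArith Setoid Morphisms.

Set Implicit Arguments.
Unset Strict Implicit.
Unset Printing Implicit Defensive.

Local Open Scope twocat_scope.

(** Everything rests on two observations.  First, a 2-kernel of [f] depends only
    on the class of 1-cells that [f] sends to zero ([is_2kernel_of_same_null]);
    hence a normal 2-monomorphism is the 2-kernel of any of its 2-cokernels, and
    a normal 1-cell [f ≅ m ∘ e] has the 2-kernels of [e] and the 2-cokernels of
    [m].  By uniqueness of 2-kernels and 2-cokernels, the comparison from any
    coimage to any image of a normal [f] is therefore an equivalence
    ([normal_comparison]).  Conversely, a 1-cell [i ∘ j ∘ p] with [p] a normal
    2-epimorphism, [j] an equivalence and [i] a normal 2-monomorphism is normal
    ([normal_of_comparison]).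

    Secondly, the three conditions speak of the same 1-cells.  For a normal
    complex with [d' ≅ m' ∘ e'] and [d ≅ m ∘ e], the pair [(m', e)] is an
    antinormal decomposition of zero whose dinversion is
    [coker(d') ∘ ker(d)], the 1-cell whose coimage and image are the two
    homology objects.  Conversely an antinormal decomposition [(m, e)] of zero is
    a complex [K -> X -> R] extended by zeros.  For the Pure Snake, two short
    2-exact sequences [(a, b)], [(c, d)] with [a ≅ c ∘ f] and [h ∘ b ≅ d] are the
    same thing as an antinormal decomposition [(a, d)] of zero with dinversion
    [b ∘ c]; moreover [f] is a 2-kernel and [h] a 2-cokernel of [b ∘ c], so that
    [coker(f)] and [ker(h)] are its coimage and image. *)

(** * Rewriting along invertible 2-cells *)

#[local] Instance iso1_equivalence (L : twoCategory) (A B : L) :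
  Equivalence (@iso1 L A B).
Proof.
split; [intro f; apply iso1_refl | intros f g; apply iso1_sym
       | intros f g h; apply iso1_trans].
Qed.

#[local] Instance comp_iso1 (L : twoCategory) (A B C : L) :
  Proper (@iso1 L B C ==> @iso1 L A B ==> @iso1 L A C) (@comp L A B C).
Proof. intros g g' Hg f f' Hf; now apply iso1_comp. Qed.

#[local] Instance iso_null_proper (L : bizeroTwoCategory) (A B : L) :
  Proper (@iso1 L A B ==> iff) (@iso_null L A B).
Proof.
intros f g E; split; apply iso_null_iso1; [exact E | exact (iso1_sym E)].
Qed.

(** * Equivalences *)

Lemma is_equivalence_comp (L : twoCategory) (A B C : L) (g : hom B C) (f : hom A B) :
  is_equivalence g -> is_equivalence f -> is_equivalence (g ∘ f).
Proof.
intros [g' [G1 G2]] [f' [F1 F2]]; exists (f' ∘ g'); split.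
- rewrite comp_assoc, <- (comp_assoc f' g' g), G1, comp_id_r; exact F1.
- rewrite comp_assoc, <- (comp_assoc g f f'), F2, comp_id_r; exact G2.
Qed.

Lemma is_equivalence_iso1 (L : twoCategory) (A B : L) (f g : hom A B) :
  f ≅ g -> is_equivalence f -> is_equivalence g.
Proof. intros E [f' [F1 F2]]; exists f'; now rewrite <- E. Qed.

Lemma rff_id (L : twoCategory) (A : L) : rff (id1 A).
Proof.
intros Z u v l.
destruct (cell_of_eqK (comp_id_r u)) as [cu [U1 U2]].
destruct (cell_of_eqK (comp_id_r v)) as [cv [V1 V2]].
exists (cell_of_eq (comp_id_r v) • l • cu); split.
- apply (vcomp_cancel V1).
  now rewrite rwhisker_id1, <- !vcomp_assoc, U1, vcomp_id_r.
- intros m Hm; now rewrite <- Hm, rwhisker_id1, <- vcomp_assoc, U2, vcomp_id_r.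
Qed.

Lemma rff_comp (L : twoCategory) (B Q I : L) (v : hom Q I) (q : hom B Q) :
  rff v -> rff q -> rff (v ∘ q).
Proof.
intros ffv ffq Z x y l.
destruct (cell_of_eqK (comp_assoc x v q)) as [cx [X1 X2]].
destruct (cell_of_eqK (comp_assoc y v q)) as [cy [Y1 Y2]].
destruct (ffq _ _ _ (cell_of_eq (comp_assoc y v q) • l • cx)) as [n [Hn Un]].
destruct (ffv _ _ _ n) as [m [Hm Um]].
exists m; split.
- apply (vcomp_cancel Y1).
  now rewrite rwhisker_comp, Hm, Hn, <- vcomp_assoc, X1, vcomp_id_r.
- intros m' Hm'; apply Um; symmetry; apply Un.
  now rewrite <- Hm', rwhisker_comp, <- vcomp_assoc, X2, vcomp_id_r.
Qed.

Lemma rwhisker_inj (L : twoCategory) (A B C Z : L) (j : hom B C) (g : hom A B)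
    (x y : hom C Z) (m m' : x ⇒ y) :
  rff (j ∘ g) -> m ▷ j = m' ▷ j -> m = m'.
Proof.
intros ff E.
destruct (cell_of_eqK (comp_assoc y j g)) as [cy [Y1 _]].
destruct (ff _ _ _ (m ▷ (j ∘ g))) as [n [_ U]].
transitivity n; [symmetry|]; apply U; trivial.
apply (vcomp_cancel Y1); now rewrite !rwhisker_comp, E.
Qed.

Lemma rff_equivalence (L : twoCategory) (A B : L) (j : hom A B) :
  is_equivalence j -> rff j.
Proof.
intros [g [G1 G2]].
assert (ff1 := rff_of_iso1 (iso1_sym G1) (rff_id (A := A))).
assert (ff2 := rff_of_iso1 (iso1_sym G2) (rff_id (A := B))).
intros Z x y l.
destruct (cell_of_eqK (comp_assoc x j g)) as [cx [X1 X2]].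
destruct (cell_of_eqK (comp_assoc y j g)) as [cy [Y1 Y2]].
(* Whiskering with [j ∘ g ≅ id] is full, so [l ▷ g] comes from some [m];
   whiskering with [g] is faithful, so [m] already induces [l]. *)
destruct (ff2 _ _ _ (cy • (l ▷ g) • cell_of_eq (comp_assoc x j g)))
  as [m [Hm _]].
assert (E : m ▷ j = l).
{ apply (rwhisker_inj ff1), (vcomp_cancel_r X2).
  now rewrite <- rwhisker_comp, Hm, !vcomp_assoc, Y2, vcomp_id_l. }
exists m; split; trivial.
intros m' Hm'; apply (rwhisker_inj ff2); now rewrite E.
Qed.

(** * Null 1-cells *)

Lemma null_iso1 (L : bizeroTwoCategory) (A B : L) (f g : hom A B) :
  null f -> null g -> f ≅ g.
Proof.
intros Hf Hg; destruct (zero_strong_bizero L) as [_ st].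
assert (one : forall (h h' : hom A B) (x y : h ⇒ h'), null h -> null h' -> x = y).
{ intros h h' x y Hh Hh'; destruct (st _ _ h h' Hh Hh') as [z [_ U]].
  transitivity z; [symmetry|]; now apply U. }
destruct (st _ _ f g Hf Hg) as [x _], (st _ _ g f Hg Hf) as [y _].
exists x, y; split; now apply one.
Qed.

Lemma hom_to_zero (L : bizeroTwoCategory) (A : L) : exists t : hom A (zero L), True.
Proof.
destruct (zero_strong_bizero L) as [bz _], (bz A) as [[c _] _]; now exists c.
Qed.

Lemma hom_from_zero (L : bizeroTwoCategory) (A : L) : exists t : hom (zero L) A, True.
Proof.
destruct (zero_strong_bizero L) as [bz _], (bz A) as [_ [c _]]; now exists c.
Qed.

Lemma null_comp (L : bizeroTwoCategory) (A B : L)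
    (t : hom (zero L) B) (s : hom A (zero L)) : null (t ∘ s).
Proof. now exists s, t. Qed.

Lemma null_to_zero (L : bizeroTwoCategory) (A : L) (s : hom A (zero L)) : null s.
Proof. exists s, (id1 _); now rewrite comp_id_l. Qed.

Lemma null_from_zero (L : bizeroTwoCategory) (A : L) (s : hom (zero L) A) : null s.
Proof. exists (id1 _), s; now rewrite comp_id_r. Qed.

Lemma iso_null_of_null (L : bizeroTwoCategory) (A B : L) (f : hom A B) :
  null f -> iso_null f.
Proof. intro H; exists f; split; [exact H | reflexivity]. Qed.

Lemma iso_null_lff (L : bizeroTwoCategory) (C K A : L) (k : hom K A) (t : hom C K) :
  lff k -> iso_null (k ∘ t) -> iso_null t.
Proof.
intros ff [o [[a [b Ho]] E]].
destruct (hom_from_zero K) as [c _].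
exists (c ∘ a); split; [apply null_comp|].
apply (lff_iso1 ff); rewrite E, Ho, comp_assoc.
apply null_iso1; apply null_comp.
Qed.

(** The 1-cells out of and into the zero object are 2-kernels and 2-cokernels of
    identities, because between 1-cells through zero there is just one 2-cell. *)
Lemma from_zero_is_2kernel (L : bizeroTwoCategory) (A : L) (t : hom (zero L) A) :
  is_2kernel (id1 A) t.
Proof.
destruct (zero_strong_bizero L) as [_ st]; split; [|split].
- rewrite comp_id_l; apply iso_null_of_null, null_from_zero.
- intros Z z [o [[a [b Ho]] E]]; exists a.
  rewrite comp_id_l in E; rewrite E, Ho; apply null_iso1; apply null_comp.
- intros Z u v l.
  destruct (st _ _ u v (null_to_zero u) (null_to_zero v)) as [m [_ U]].
  destruct (st _ _ (t ∘ u) (t ∘ v) (null_comp t u) (null_comp t v)) as [n [_ V]].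
  exists m; split; [|intros m' _; now apply U].
  transitivity n; [symmetry|]; now apply V.
Qed.

Lemma to_zero_is_2cokernel (L : bizeroTwoCategory) (A : L) (t : hom A (zero L)) :
  is_2cokernel (id1 A) t.
Proof.
destruct (zero_strong_bizero L) as [_ st]; split; [|split].
- rewrite comp_id_r; apply iso_null_of_null, null_to_zero.
- intros Z z [o [[a [b Ho]] E]]; exists b.
  rewrite comp_id_r in E; rewrite E, Ho; apply null_iso1; apply null_comp.
- intros Z u v l.
  destruct (st _ _ u v (null_from_zero u) (null_from_zero v)) as [m [_ U]].
  destruct (st _ _ (u ∘ t) (v ∘ t) (null_comp u t) (null_comp v t)) as [n [_ V]].
  exists m; split; [|intros m' _; now apply U].
  transitivity n; [symmetry|]; now apply V.
Qed.

(** * 2-kernels and 2-cokernels *)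

Lemma lff_id (L : twoCategory) (A : L) : lff (id1 A).
Proof.
intros Z u v l.
destruct (cell_of_eqK (comp_id_l u)) as [cu [U1 U2]].
destruct (cell_of_eqK (comp_id_l v)) as [cv [V1 V2]].
exists (cell_of_eq (comp_id_l v) • l • cu); split.
- apply (vcomp_cancel V1).
  now rewrite lwhisker_id1, <- !vcomp_assoc, U1, vcomp_id_r.
- intros m Hm; now rewrite <- Hm, lwhisker_id1, <- vcomp_assoc, U2, vcomp_id_r.
Qed.

Lemma id_is_2kernel (L : bizeroTwoCategory) (A : L) (t : hom A (zero L)) :
  is_2kernel t (id1 A).
Proof.
split; [|split].
- apply iso_null_of_null, null_to_zero.
- intros Z z _; exists z; now rewrite comp_id_l.
- apply lff_id.
Qed.

Lemma id_is_2cokernel (L : bizeroTwoCategory) (A : L) (t : hom (zero L) A) :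
  is_2cokernel t (id1 A).
Proof.
split; [|split].
- apply iso_null_of_null, null_from_zero.
- intros Z z _; exists z; now rewrite comp_id_r.
- apply rff_id.
Qed.

Lemma is_2kernel_of_same_null (L : bizeroTwoCategory) (A B C K : L)
    (f : hom A B) (g : hom A C) (k : hom K A) :
  (forall (Z : L) (z : hom Z A), iso_null (f ∘ z) <-> iso_null (g ∘ z)) ->
  is_2kernel f k -> is_2kernel g k.
Proof.
intros E [k0 [klift ffk]]; split; [|split]; trivial.
- now apply E.
- intros Z z Hz; now apply klift, E.
Qed.

Lemma is_2cokernel_of_same_null (L : bizeroTwoCategory) (A B C Q : L)
    (f : hom A B) (g : hom C B) (q : hom B Q) :
  (forall (Z : L) (z : hom B Z), iso_null (z ∘ f) <-> iso_null (z ∘ g)) ->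
  is_2cokernel f q -> is_2cokernel g q.
Proof.
intros E [q0 [qlift ffq]]; split; [|split]; trivial.
- now apply E.
- intros Z z Hz; now apply qlift, E.
Qed.

Lemma normal_mono_is_2kernel (L : bizeroTwoCategory) (K A Q : L)
    (k : hom K A) (q : hom A Q) :
  is_normal_mono k -> is_2cokernel k q -> is_2kernel q k.
Proof.
intros [B [f Hk]] [q0 [qlift _]].
refine (is_2kernel_of_same_null _ Hk); intros Z z; split; intro Hz.
- destruct Hk as [_ [klift _]], (klift _ z Hz) as [u Eu].
  rewrite <- Eu, comp_assoc; now apply iso_null_comp_r.
- destruct Hk as [k0 _], (qlift _ f k0) as [t Et].
  rewrite <- Et, <- comp_assoc; now apply iso_null_comp_l.
Qed.

Lemma normal_epi_is_2cokernel (L : bizeroTwoCategory) (K A Q : L)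
    (k : hom K A) (q : hom A Q) :
  is_normal_epi q -> is_2kernel q k -> is_2cokernel k q.
Proof.
intros [B [f Hq]] [k0 [klift _]].
refine (is_2cokernel_of_same_null _ Hq); intros Z z; split; intro Hz.
- destruct Hq as [_ [qlift _]], (qlift _ z Hz) as [u Eu].
  rewrite <- Eu, <- comp_assoc; now apply iso_null_comp_l.
- destruct Hq as [q0 _], (klift _ f q0) as [t Et].
  rewrite <- Et, comp_assoc; now apply iso_null_comp_r.
Qed.

Lemma normal_mono_lff (L : bizeroTwoCategory) (K A : L) (k : hom K A) :
  is_normal_mono k -> lff k.
Proof. intros [B [f [_ [_ ff]]]]; exact ff. Qed.

Lemma normal_epi_rff (L : bizeroTwoCategory) (A Q : L) (q : hom A Q) :
  is_normal_epi q -> rff q.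
Proof. intros [B [f [_ [_ ff]]]]; exact ff. Qed.

Lemma is_2kernel_factor (L : bizeroTwoCategory) (A B I K : L) (f : hom A B)
    (e : hom A I) (m : hom I B) (k : hom K A) :
  is_normal_mono m -> f ≅ m ∘ e -> is_2kernel f k -> is_2kernel e k.
Proof.
intros Hm E; apply is_2kernel_of_same_null; intros Z z.
rewrite E, <- comp_assoc; split; [|apply iso_null_comp_l].
now apply iso_null_lff, normal_mono_lff.
Qed.

Lemma is_2cokernel_factor (L : bizeroTwoCategory) (A B I Q : L) (f : hom A B)
    (e : hom A I) (m : hom I B) (q : hom B Q) :
  is_normal_epi e -> f ≅ m ∘ e -> is_2cokernel f q -> is_2cokernel m q.
Proof.
intros He E; apply is_2cokernel_of_same_null; intros Z z.
rewrite E, comp_assoc; split; [|apply iso_null_comp_r].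
now apply iso_null_rff, normal_epi_rff.
Qed.

Lemma is_2kernel_unique (L : bizeroTwoCategory) (A B K K' : L) (f : hom A B)
    (k : hom K A) (k' : hom K' A) :
  is_2kernel f k -> is_2kernel f k' ->
  exists s : hom K K', is_equivalence s /\ k' ∘ s ≅ k.
Proof.
intros [k0 [klift ffk]] [k0' [klift' ffk']].
destruct (klift' _ k k0) as [s Es], (klift _ k' k0') as [t Et].
exists s; split; trivial; exists t; split.
- apply (lff_iso1 ffk); now rewrite comp_assoc, Et, comp_id_r.
- apply (lff_iso1 ffk'); now rewrite comp_assoc, Es, comp_id_r.
Qed.

Lemma is_2cokernel_unique (L : bizeroTwoCategory) (A B Q Q' : L) (f : hom A B)
    (q : hom B Q) (q' : hom B Q') :
  is_2cokernel f q -> is_2cokernel f q' ->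
  exists s : hom Q Q', is_equivalence s /\ s ∘ q ≅ q'.
Proof.
intros [q0 [qlift ffq]] [q0' [qlift' ffq']].
destruct (qlift _ q' q0') as [s Es], (qlift' _ q q0) as [t Et].
exists s; split; trivial; exists t; split.
- apply (rff_iso1 ffq); now rewrite <- comp_assoc, Es, comp_id_l.
- apply (rff_iso1 ffq'); now rewrite <- comp_assoc, Et, comp_id_l.
Qed.

Lemma is_2cokernel_equivalence (L : bizeroTwoCategory) (A B Q Q' : L) (f : hom A B)
    (q : hom B Q) (j : hom Q Q') :
  is_2cokernel f q -> is_equivalence j -> is_2cokernel f (j ∘ q).
Proof.
intros [q0 [qlift ffq]] Hj; split; [|split].
- rewrite <- comp_assoc; now apply iso_null_comp_l.
- intros Z z Hz; destruct (qlift _ z Hz) as [x Ex], Hj as [g [G _]].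
  exists (x ∘ g).
  now rewrite comp_assoc, <- (comp_assoc x g j), G, comp_id_r.
- apply rff_comp; [now apply rff_equivalence | exact ffq].
Qed.

(** * Normal 1-cells and comparisons *)

Lemma normal_comparison (L : bizeroTwoCategory) (A B I J : L) (f : hom A B)
    (p : hom A I) (i : hom J B) (j : hom I J) :
  is_normal f -> is_coim f p -> is_im f i -> is_comparison f p i j ->
  is_equivalence j.
Proof.
intros [N [e [m [He [Hm Ef]]]]] [K [k [Hk Hp]]] [Q [q [Hq Hi]]] Ej.
assert (He' := normal_epi_is_2cokernel He (is_2kernel_factor Hm Ef Hk)).
assert (Hm' := normal_mono_is_2kernel Hm (is_2cokernel_factor He Ef Hq)).
destruct (is_2cokernel_unique Hp He') as [s [Hs Es]].
destruct (is_2kernel_unique Hm' Hi) as [y [Hy Ey]].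
apply (@is_equivalence_iso1 L _ _ (y ∘ s)); [|now apply is_equivalence_comp].
destruct Hp as [_ [_ ffp]], Hi as [_ [_ ffi]].
apply (rff_iso1 ffp), (lff_iso1 ffi).
rewrite <- comp_assoc, Es, !comp_assoc, Ey, <- Ef; symmetry; exact Ej.
Qed.

Lemma normal_of_comparison (L : bizeroTwoCategory) (A B I J : L) (f : hom A B)
    (p : hom A I) (i : hom J B) (j : hom I J) :
  is_normal_epi p -> is_normal_mono i -> is_comparison f p i j ->
  is_equivalence j -> is_normal f.
Proof.
intros [C [g Hp]] Hi Ej Hj; exists J, (j ∘ p), i; split; [|split]; trivial.
- exists C, g; now apply is_2cokernel_equivalence.
- rewrite comp_assoc; symmetry; exact Ej.
Qed.

Lemma normal_mono_is_normal (L : bizeroTwoCategory) (A B : L) (m : hom A B) :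
  is_normal_mono m -> is_normal m.
Proof.
intro Hm; exists A, (id1 A), m; split; [|split]; trivial.
- destruct (hom_from_zero A) as [t _]; exists (zero L), t; apply id_is_2cokernel.
- now rewrite comp_id_r.
Qed.

Lemma normal_epi_is_normal (L : bizeroTwoCategory) (A B : L) (e : hom A B) :
  is_normal_epi e -> is_normal e.
Proof.
intro He; exists B, e, (id1 B); split; [|split]; trivial.
- destruct (hom_to_zero B) as [t _]; exists (zero L), t; apply id_is_2kernel.
- now rewrite comp_id_l.
Qed.

Lemma null_is_normal (L : bizeroTwoCategory) (A B : L) (f : hom A B) :
  null f -> is_normal f.
Proof.
intros [s [t ->]]; exists (zero L), s, t; split; [|split].
- exists A, (id1 A); apply to_zero_is_2cokernel.
- exists B, (id1 B); apply from_zero_is_2kernel.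
- reflexivity.
Qed.

(** * Homology and dinversions *)

Lemma self_dual_homology (L : bizeroTwoCategory) :
  homologically_self_dual L -> homology_self_dual L.
Proof.
intros HSD C n K Q k q Hk Hq Hc Hk' p i Hp Hi j Ej.
refine (normal_comparison _ (Hcoker_is_coim Hk Hq Hp) (Hker_is_im Hk Hq Hi) Ej).
destruct (diff_normal C (n + 1)) as [N' [e' [m' [He' [Hm' Ed']]]]].
destruct (diff_normal C n) as [N [e [m [He [Hm Ed]]]]].
apply (HSD _ _ _ m' e); trivial.
- (* [m ∘ (e ∘ m') ∘ e'] is null, and [m] and [e'] reflect null 1-cells. *)
  apply (iso_null_rff (normal_epi_rff He')), (iso_null_lff (normal_mono_lff Hm)).
  assert (H := diff_null C n); rewrite Ed, Ed' in H.
  now rewrite !comp_assoc in *.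
- exact (is_2cokernel_factor He' Ed' Hq).
- exact (is_2kernel_factor Hm Ed Hk).
Qed.

(** The objects of the complex [... 0 -> K -> X -> R -> 0 ...], with [R] in
    degree 0. *)
Definition short_term (L : bizeroTwoCategory) (K X R : L) (n : Z) : L :=
  match n with
  | 0%Z => R
  | 1%Z => X
  | 2%Z => K
  | _ => zero L
  end.

(** Its differentials; [o] supplies the zero 1-cells of the remaining degrees. *)
Definition short_diff (L : bizeroTwoCategory) (K X R : L)
    (m : hom K X) (e : hom X R)
    (o : forall n : Z, hom (short_term K X R (n + 1)) (short_term K X R n))
    (n : Z) : hom (short_term K X R (n + 1)) (short_term K X R n) :=
  match n with
  | 0%Z => e
  | 1%Z => m
  | n' => o n'
  end.

(** Zero 1-cells are only known to exist propositionally; choosing 1-cells to and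
    from zero for the three objects yields the whole family without an axiom of
    choice. *)
Lemma short_null_diff (L : bizeroTwoCategory) (K X R : L) :
  exists o : forall n : Z, hom (short_term K X R (n + 1)) (short_term K X R n),
    forall n, null (o n).
Proof.
destruct (hom_to_zero K) as [tK _], (hom_from_zero K) as [sK _].
destruct (hom_to_zero X) as [tX _], (hom_from_zero X) as [sX _].
destruct (hom_to_zero R) as [tR _], (hom_from_zero R) as [sR _].
assert (t : forall n, hom (short_term K X R n) (zero L)).
{ intros [|[p|[p|p|]|]|p]; simpl; trivial; exact (id1 _). }
assert (s : forall n, hom (zero L) (short_term K X R n)).
{ intros [|[p|[p|p|]|]|p]; simpl; trivial; exact (id1 _). }
exists (fun n => s n ∘ t (n + 1)%Z); intro n; apply null_comp.
Qed.

(** Self-duality of homology for a single composable pair of normal 1-cells,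
    seen as a complex extended by zeros. *)
Lemma homology_self_dual_pair (L : bizeroTwoCategory) :
  homology_self_dual L ->
  forall (K X R : L) (m : hom K X) (e : hom X R),
    is_normal m -> is_normal e -> iso_null (e ∘ m) ->
    forall (M N : L) (k : hom M X) (q : hom X N),
      is_2kernel e k -> is_2cokernel m q ->
      forall (Hc Hk : L) (p : hom M Hc) (i : hom Hk N),
        is_Hcoker m k p -> is_Hker e q i ->
        forall j : hom Hc Hk, is_comparison (q ∘ k) p i j -> is_equivalence j.
Proof.
intros H K X R m e Hm He Hem.
destruct (short_null_diff K X R) as [o Ho].
assert (dnormal : forall n, is_normal (short_diff m e o n)).
{ intros [|[p|p|]|p]; try exact Hm; try exact He; apply null_is_normal, Ho. }
assert (dnull : forall n,
  iso_null (short_diff m e o n ∘ short_diff m e o (n + 1)%Z)).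
{ intros [|[p|p|]|p]; try exact Hem;
    try (apply iso_null_comp_r, iso_null_of_null, Ho).
  (* the remaining composite is the differential [0 -> K] followed by [m] *)
  apply iso_null_comp_l, iso_null_of_null, (Ho 2%Z). }
exact (H (NormalComplex dnormal dnull) 0%Z).
Qed.

Lemma homology_dinversion (L : bizeroTwoCategory) :
  is_2z_exact L -> homology_self_dual L -> homologically_self_dual L.
Proof.
intros [kers cokers] H K X R m e Hm He Hem M N q k Hq Hk.
(* As [(m, q)] and [(k, e)] are short 2-exact, [m] is its own image and [e] its
   own coimage. *)
assert (Hm' := normal_mono_is_2kernel Hm Hq).
assert (He' := normal_epi_is_2cokernel He Hk).
destruct Hk as [k0 [klift ffk]], Hq as [q0 [qlift ffq]].
destruct (klift _ m Hem) as [u Eu], (qlift _ e Hem) as [v Ev].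
destruct (cokers _ _ u) as [Hc [p Hp]], (kers _ _ v) as [Hk [i Hi]].
assert (Hpc : is_Hcoker m k p).
{ exists K, m, u; split; [|now split].
  exists N, q; split; [now split|exact Hm']. }
assert (Hik : is_Hker e q i).
{ exists R, e, v; split; [|now split].
  exists M, k; split; [now split|exact He']. }
assert (Hq := conj q0 (conj qlift ffq) : is_2cokernel m q).
assert (Hk' := conj k0 (conj klift ffk) : is_2kernel e k).
destruct (comparison_exists (Hcoker_is_coim Hk' Hq Hpc) (Hker_is_im Hk' Hq Hik))
  as [j Ej].
apply (@normal_of_comparison L _ _ _ _ _ p i j); trivial.
- now exists K, u.
- now exists R, v.
- exact (homology_self_dual_pair H (normal_mono_is_normal Hm)
    (normal_epi_is_normal He) Hem Hk' Hq Hpc Hik Ej).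
Qed.

(** * The Pure Snake and dinversions *)

Lemma snake_is_2kernel (L : bizeroTwoCategory) (A B C X : L)
    (a : hom A B) (b : hom B C) (c : hom X B) (f : hom A X) :
  is_2kernel b a -> lff c -> a ≅ c ∘ f -> is_2kernel (b ∘ c) f.
Proof.
intros [a0 [alift ffa]] ffc E; split; [|split].
- rewrite <- comp_assoc, <- E; exact a0.
- intros Z z Hz; rewrite <- comp_assoc in Hz.
  destruct (alift _ _ Hz) as [x Ex]; exists x; apply (lff_iso1 ffc).
  now rewrite comp_assoc, <- E.
- exact (lff_cancel ffc (lff_of_iso1 E ffa)).
Qed.

Lemma snake_is_2cokernel (L : bizeroTwoCategory) (B C X Z : L)
    (b : hom B C) (c : hom X B) (d : hom B Z) (h : hom C Z) :
  is_2cokernel c d -> rff b -> h ∘ b ≅ d -> is_2cokernel (b ∘ c) h.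
Proof.
intros [d0 [dlift ffd]] ffb E; split; [|split].
- rewrite comp_assoc, E; exact d0.
- intros Y z Hz; rewrite comp_assoc in Hz.
  destruct (dlift _ _ Hz) as [x Ex]; exists x; apply (rff_iso1 ffb).
  now rewrite <- comp_assoc, E.
- exact (rff_cancel ffb (rff_of_iso1 (iso1_sym E) ffd)).
Qed.

Lemma self_dual_pure_snake (L : bizeroTwoCategory) :
  homologically_self_dual L -> pure_snake L.
Proof.
intros HSD A B C X Z a b c d f h [Ha Hb] [Hc Hd] Ef Eh Q K q k Hq Hk j Ej.
assert (Hf := snake_is_2kernel Ha (proj2 (proj2 Hc)) Ef).
assert (Hh := snake_is_2cokernel Hd (proj2 (proj2 Hb)) Eh).
refine (normal_comparison (f := b ∘ c) (p := q) (i := k) _ _ _ Ej).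
- apply (HSD _ _ _ a d); trivial.
  + now exists C, b.
  + now exists X, c.
  + rewrite Ef, comp_assoc; apply iso_null_comp_r, Hd.
- now exists A, f.
- now exists Z, h.
Qed.

Lemma pure_snake_self_dual (L : bizeroTwoCategory) :
  is_2z_exact L -> pure_snake L -> homologically_self_dual L.
Proof.
intros [kers cokers] PS K X R m e Hm He Hem M N q k Hq Hk.
assert (Sm : short_2exact m q) by (split; [now apply normal_mono_is_2kernel|exact Hq]).
assert (Se : short_2exact k e) by (split; [exact Hk|now apply normal_epi_is_2cokernel]).
destruct (proj1 (proj2 Hk) _ m Hem) as [f Ef], (proj1 (proj2 Hq) _ e Hem) as [h Eh].
destruct (cokers _ _ f) as [Q [p Hp]], (kers _ _ h) as [J [i Hi]].
apply iso1_sym in Ef.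
destruct (pure_snake_comparison_exists Sm Se Ef Eh Hp Hi) as [j Ej].
apply (@normal_of_comparison L _ _ _ _ _ p i j); trivial.
- now exists K, f.
- now exists R, h.
- exact (PS _ _ _ _ _ _ _ _ _ _ _ Sm Se Ef Eh _ _ _ _ Hp Hi _ Ej).
Qed.

Theorem proposition4p18 (L : bizeroTwoCategory) (exactL : is_2z_exact L) :
  (homologically_self_dual L <-> homology_self_dual L) /\
  (homology_self_dual L <-> pure_snake L).
Proof.
split; split; intro H.
- now apply self_dual_homology.
- now apply homology_dinversion.
- now apply self_dual_pure_snake, homology_dinversion.
- now apply self_dual_homology, pure_snake_self_dual.
Qed.
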